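(* (i) Let $(\mathcal A,\mu,\alpha)$ be a multiplicative super-commutative Hom-associative superalgebra and let $\mathfrak B$ be a nondegenerate super-commutative Connes cocycle on $(\mathcal A,\mu,\alpha)$ satisfying $\mathfrak B(\alpha(x),\alpha(y))=\mathfrak B(x,y)$ for all homogeneous $x,y\in\mathcal A$. Then there exists a compatible Hom-anti-Zinbiel superalgebra structure $(\mathcal A,\star,\alpha)$ on $(\mathcal A,\mu,\alpha)$ defined by $$\mathfrak B(x\star y,\alpha(z))=-(-1)^{|x||y|}\,\mathfrak B(\alpha(y),\mu(x,z))$$ for all homogeneous $x,y,z\in\mathcal A$. (ii) Conversely, let $(\mathcal A,\star,\alpha)$ be a multiplicative Hom-anti-Zinbiel superalgebra with $\alpha$ bijective, and let $(\mathcal A,\mu,\alpha)$, $\mu(x,y)=x\star y+(-1)^{|x||y|}y\star x$, be its sub-adjacent super-commutative Hom-associative superalgebra. Then the natural nondegenerate supersymmetric bilinear form $\mathfrak B_d$ on $\mathcal A\oplus\mathcal A^*$ is a super-commutative Connes cocycle on the super-commutative Hom-associative superalgebra $\mathcal A\ltimes_{\mathfrak L_\star^\star}\mathcal A^*$.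
   Context: All vector spaces are finite-dimensional over a field $\mathbb K$ of characteristic $0$. Superspaces are $\mathbb Z_2$-graded, $|x|$ is the parity of a homogeneous element $x$, and identities are required for homogeneous elements. Even maps preserve parity. A super-commutative Hom-associative superalgebra is a triple $(\mathcal A,\mu,\alpha)$ with $\mathcal A$ a $\mathbb Z_2$-graded vector space, $\alpha:\mathcal A\to\mathcal A$ an even linear map and $\mu:\mathcal A\times\mathcal A\to\mathcal A$ an even bilinear map such that $\mu(x,y)=(-1)^{|x||y|}\mu(y,x)$ and $\mu(\mu(x,y),\alpha(z))=\mu(\alpha(x),\mu(y,z))$. It is multiplicative if $\alpha(\mu(x,y))=\mu(\alpha(x),\alpha(y))$. A Hom-anti-Zinbiel superalgebra is a triple $(\mathcal A,\star,\alpha)$ with $\star$ an even bilinear operation and $\alpha$ an even linear map on $\mathcal A$ such that $\alpha(x)\star(y\star z)=-(x\star y+(-1)^{|x||y|}y\star x)\star\alpha(z)$ and $\alpha(x)\star(y\star z)=(-1)^{|x|(|y|+|z|)}\alpha(y)\star(z\star x)$. It is multiplicative if $\alpha(x\star y)=\alpha(x)\star\alpha(y)$. For such a structure, $\mu_\star(x,y)=x\star y+(-1)^{|x||y|}y\star x$ makes $(\mathcal A,\mu_\star,\alpha)$ a super-commutative Hom-associative superalgebra, called sub-adjacent; $(\mathcal A,\star,\alpha)$ is called compatible with $(\mathcal A,\mu,\alpha)$ if $\mu_\star=\mu$. A super-commutative Connes cocycle on $(\mathcal A,\mu,\alpha)$ is an even bilinear form $\mathfrak B:\mathcal A\times\mathcal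 A\to\mathbb K$ (i.e. $\mathfrak B(\mathcal A_{\bar 0},\mathcal A_{\bar 1})=\mathfrak B(\mathcal A_{\bar 1},\mathcal A_{\bar 0})=0$) that is supersymmetric, $\mathfrak B(x,y)=(-1)^{|x||y|}\mathfrak B(y,x)$, and satisfies $\mathfrak B(\mu(x,y),\alpha(z))+(-1)^{|x|(|y|+|z|)}\mathfrak B(\mu(y,z),\alpha(x))+(-1)^{|z|(|x|+|y|)}\mathfrak B(\mu(z,x),\alpha(y))=0$. For $\alpha$ bijective, $\mathfrak L_\star^\star:\mathcal A\to gl(\mathcal A^* )$ is given by $\langle\mathfrak L_\star^\star(x)\xi,v\rangle=-(-1)^{|x||\xi|}\langle\xi,\alpha^{-1}(x)\star\alpha^{-2}(v)\rangle$, and $(\alpha^{-1})^*$ is the transpose of $\alpha^{-1}$. The superalgebra $\mathcal A\ltimes_{\mathfrak L_\star^\star}\mathcal A^*$ is $\mathcal A\oplus\mathcal A^*$ with twisting map $\alpha\oplus(\alpha^{-1})^*$ and product $(x+\xi)\cdot(y+\zeta)=\mu(x,y)+\mathfrak L_\star^\star(x)\zeta+(-1)^{|y||\xi|}\mathfrak L_\star^\star(y)\xi$. The natural form is $\mathfrak B_d(x+\xi,y+\zeta)=\langle x,\zeta\rangle+\langle\xi,y\rangle$, where $\langle\xi,y\rangle=\xi(y)$ and $\langle x,\zeta\rangle=(-1)^{|x||\zeta|}\zeta(x)$. *)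

(* Defs.v *)
From HB Require Import structures.
From mathcomp Require Import all_boot all_order all_algebra.

Set Implicit Arguments.
Unset Strict Implicit.
Unset Printing Implicit Defensive.

Import GRing.Theory.
Local Open Scope ring_scope.

(* Parities are booleans, [true] being odd; in a sign exponent they are coerced
   to 0 or 1 in nat. *)
Record superspace (K : fieldType) := Superspace {
  superspace_vect :> vectType K;
  parity : bool -> {vspace superspace_vect};
  parity_sum : (parity false + parity true = fullv)%VS;
  parity_cap : (parity false :&: parity true = 0)%VS
}.

Section Superspaces.
Variable K : fieldType.
Implicit Types A V : superspace K.

Definition hproj A (i : bool) : 'End(A) :=
  daddv_pi (parity A i) (parity A (~~ i)).

Lemma parity_capN A i : (parity A i :&: parity A (~~ i) = 0)%VS.
Proof. by case: i; rewrite /= ?[(parity A true :&: _)%VS]capvC parity_cap. Qed.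

Lemma mem_hproj A i x : hproj A i x \in parity A i.
Proof. exact: memv_pi. Qed.

Lemma hproj_id A i x : x \in parity A i -> hproj A i x = x.
Proof. by move=> xi; apply: daddv_pi_id => //; apply: parity_capN. Qed.

Lemma hproj_sum A x : hproj A false x + hproj A true x = x.
Proof.
apply: daddv_pi_add; first exact: parity_cap.
by rewrite parity_sum memvf.
Qed.

Lemma hproj_eq0 A i x : x \in parity A i -> hproj A (~~ i) x = 0.
Proof.
move=> xi; have := hproj_sum x; case: i xi => xi /=; rewrite (hproj_id xi).
  by move/(canRL (addrK _)); rewrite subrr.
by rewrite addrC => /(canRL (addrK _)); rewrite subrr.
Qed.

(* [sflip f] is the bilinear extension of (x, y) |-> (-1)^(|x||y|) f(y, x);
   see [sflipE]. *)
Definition sflip A V (W : lmodType K) (f : V -> A -> W) (x : A) (y : V) : W :=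
  \sum_(i : bool) \sum_(j : bool)
    (-1) ^+ (i * j) *: f (hproj V j y) (hproj A i x).

Lemma sflipE A V (W : lmodType K) (f : V -> A -> W) i j x y :
    (forall x, f 0 x = 0) -> (forall y, f y 0 = 0) ->
    x \in parity A i -> y \in parity V j ->
  sflip f x y = (-1) ^+ (i * j) *: f y x.
Proof.
move=> f0l f0r xi yj; have xn := hproj_eq0 xi; have yn := hproj_eq0 yj.
rewrite /sflip !big_bool /=.
by case: i j xi yj xn yn => [] [] /hproj_id-> /hproj_id-> /= -> ->;
   rewrite ?f0l ?f0r ?scaler0 ?addr0 ?add0r ?scaler0.
Qed.

Definition transpose_lfun (U W : vectType K) (f : 'Hom(U, W)) :
    'Hom('Hom(W, K^o), 'Hom(U, K^o)) :=
  linfun (fun xi : 'Hom(W, K^o) => xi \o f)%VF.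

Lemma transpose_lfunE (U W : vectType K) (f : 'Hom(U, W)) xi :
  transpose_lfun f xi = (xi \o f)%VF.
Proof.
have lin : linear (fun xi : 'Hom(W, K^o) => xi \o f)%VF.
  by move=> a u v; rewrite comp_lfunDl comp_lfunZl.
pose g := HB.pack_for {linear 'Hom(W, K^o) -> 'Hom(U, K^o)}
  (fun xi : 'Hom(W, K^o) => (xi \o f)%VF)
  (GRing.isLinear.Build _ _ _ _ _ lin).
exact: (lfunE g xi).
Qed.

(* The functionals of parity [i] are those vanishing on vectors of the other
   parity; see [mem_sdual_parity]. *)
Definition sdual_parity A (i : bool) : {vspace 'Hom(A, K^o)} :=
  lker (transpose_lfun (hproj A (~~ i))).

Lemma mem_sdual_parity A i (xi : 'Hom(A, K^o)) :
  xi \in sdual_parity A i <-> (forall v, v \in parity A (~~ i) -> xi v = 0).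
Proof.
rewrite memv_ker transpose_lfunE; split=> [/eqP xi0 v vi|xi0].
  by rewrite -[v in LHS](hproj_id vi) -comp_lfunE xi0 lfunE.
apply/eqP/lfunP=> v; rewrite comp_lfunE xi0 ?mem_hproj //.
by rewrite lfunE.
Qed.

Fact sdual_parity_sum A :
  (sdual_parity A false + sdual_parity A true = fullv)%VS.
Proof.
apply/vspaceP=> xi; rewrite memvf.
have -> : xi = ((xi \o hproj A false) + (xi \o hproj A true))%VF.
  by apply/lfunP=> v; rewrite lfun_simp !comp_lfunE -linearD hproj_sum.
apply: memv_add; apply/mem_sdual_parity => v /hproj_eq0/= v0;
  by rewrite comp_lfunE v0 linear0.
Qed.

Fact sdual_parity_cap A :
  (sdual_parity A false :&: sdual_parity A true = 0)%VS.
Proof.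
apply/eqP; rewrite -subv0; apply/subvP=> xi /memv_capP[].
move=> /mem_sdual_parity xi1 /mem_sdual_parity xi0.
rewrite memv0; apply/eqP/lfunP=> v.
rewrite -[v in LHS]hproj_sum linearD lfunE /=.
by rewrite (xi0 _ (mem_hproj _ _)) (xi1 _ (mem_hproj _ _)) addr0.
Qed.

Definition sdual A : superspace K :=
  Superspace (sdual_parity_sum A) (sdual_parity_cap A).

Definition ssum_parity A V (i : bool) : {vspace (A * V)%type} :=
  (linfun fst @^-1: parity A i :&: linfun snd @^-1: parity V i)%VS.

Lemma mem_ssum_parity A V i (p : A * V) :
  (p \in ssum_parity A V i) = (p.1 \in parity A i) && (p.2 \in parity V i).
Proof. by rewrite memv_cap -!memv_preim !lfunE. Qed.

Fact ssum_parity_sum A V :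
  (ssum_parity A V false + ssum_parity A V true = fullv)%VS.
Proof.
apply/vspaceP=> -[x y]; rewrite memvf.
have -> : (x, y) = (hproj A false x, hproj V false y)
                   + (hproj A true x, hproj V true y).
  by congr pair; rewrite /= hproj_sum.
by apply: memv_add; rewrite mem_ssum_parity !mem_hproj.
Qed.

Fact ssum_parity_cap A V :
  (ssum_parity A V false :&: ssum_parity A V true = 0)%VS.
Proof.
apply/eqP; rewrite -subv0; apply/subvP=> -[x y].
rewrite memv_cap !mem_ssum_parity /= => /andP[/andP[x0 y0] /andP[x1 y1]].
have xE : x = 0 by apply/eqP; rewrite -memv0 -(parity_cap A) memv_cap x0.
have yE : y = 0 by apply/eqP; rewrite -memv0 -(parity_cap V) memv_cap y0.
by rewrite memv0 xE yE.
Qed.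

Definition ssum A V : superspace K :=
  Superspace (ssum_parity_sum A V) (ssum_parity_cap A V).

End Superspaces.

Section Structures.
Variables (K : fieldType) (A : superspace K).
Implicit Types (mu star : A -> A -> A) (alpha : 'End(A)) (B : A -> A -> K).

Definition even_linear alpha :=
  forall i x, x \in parity A i -> alpha x \in parity A i.

Definition even_bilinear mu :=
  bilinear_for *:%R *:%R mu /\
  forall i j x y, x \in parity A i -> y \in parity A j ->
    mu x y \in parity A (i (+) j).

Definition supercommutative mu :=
  forall i j x y, x \in parity A i -> y \in parity A j ->
    mu x y = (-1) ^+ (i * j) *: mu y x.

Definition hom_associative mu alpha :=
  forall i j k x y z,
    x \in parity A i -> y \in parity A j -> z \in parity A k ->
    mu (mu x y) (alpha z) = mu (alpha x) (mu y z).

Definition supercomm_hom_assoc mu alpha :=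
  [/\ even_bilinear mu, even_linear alpha,
      supercommutative mu & hom_associative mu alpha].

Definition hom_multiplicative mu alpha :=
  forall i j x y, x \in parity A i -> y \in parity A j ->
    alpha (mu x y) = mu (alpha x) (alpha y).

Definition hom_anti_zinbiel star alpha :=
  [/\ even_bilinear star, even_linear alpha,
      forall i j k x y z,
        x \in parity A i -> y \in parity A j -> z \in parity A k ->
        star (alpha x) (star y z)
          = - star (star x y + (-1) ^+ (i * j) *: star y x) (alpha z)
    & forall i j k x y z,
        x \in parity A i -> y \in parity A j -> z \in parity A k ->
        star (alpha x) (star y z)
          = (-1) ^+ (i * (j + k)) *: star (alpha y) (star z x)].

Definition subadjacent star (x y : A) : A := star x y + sflip star x y.

Definition compatible star mu := forall x y, subadjacent star x y = mu x y.

Definition even_bilinear_form B :=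
  bilinear_for *%R *%R B /\
  forall i x y, x \in parity A i -> y \in parity A (~~ i) -> B x y = 0.

Definition supersymmetric B :=
  forall i j x y, x \in parity A i -> y \in parity A j ->
    B x y = (-1) ^+ (i * j) * B y x.

Definition nondegenerate_form B :=
  (forall x, (forall y, B x y = 0) -> x = 0) /\
  (forall y, (forall x, B x y = 0) -> y = 0).

Definition connes_cocycle mu alpha B :=
  [/\ even_bilinear_form B, supersymmetric B
    & forall i j k x y z,
        x \in parity A i -> y \in parity A j -> z \in parity A k ->
        B (mu x y) (alpha z)
          + (-1) ^+ (i * (j + k)) * B (mu y z) (alpha x)
          + (-1) ^+ (k * (i + j)) * B (mu z x) (alpha y) = 0].

(* L_star^star; meaningful when [star] is bilinear and [alpha] is bijective, so
   that [alpha^-1] is the inverse of [alpha]; see [Ldual_homogE]. *)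
Definition Ldual star alpha (x : A) (xi : sdual A) : sdual A :=
  - sflip (fun (zeta : sdual A) (y : A) =>
        ((zeta : 'Hom(A, K^o)) \o
          linfun (fun v => star ((alpha^-1)%VF y)
                             ((alpha^-1)%VF ((alpha^-1)%VF v))))%VF : sdual A)
      x xi.

Lemma Ldual_homogE star alpha i j x (xi : 'Hom(A, K^o)) v :
    even_bilinear star -> x \in parity A i -> xi \in parity (sdual A) j ->
  (Ldual star alpha x xi : 'Hom(A, K^o)) v =
    - ((-1) ^+ (i * j)
       * xi (star ((alpha^-1)%VF x) ((alpha^-1)%VF ((alpha^-1)%VF v)))).
Proof.
move=> [[linl linr] _] xp xip.
pose f y v := star ((alpha^-1)%VF y) ((alpha^-1)%VF ((alpha^-1)%VF v)).
have fE y u : linfun (f y) u = f y u.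
  have lin : linear (f y) by move=> a s t; rewrite /f !linearP linr.
  pose g := HB.pack_for {linear A -> A} (f y)
    (GRing.isLinear.Build _ _ _ _ _ lin).
  exact: (lfunE g u).
rewrite /Ldual (sflipE _ _ xp xip) => [|y|zeta].
- by rewrite opp_lfunE scale_lfunE comp_lfunE (fE x v).
- exact: comp_lfun0l.
- apply/lfunP=> u; rewrite comp_lfunE (fE 0 u) /f linear0 lfunE /=.
  have s0 w : star 0 w = 0.
    by have := linl w (-1) 0 0; rewrite /= scaler0 addr0 scaleN1r addNr.
  by rewrite s0 linear0.
Qed.

End Structures.

Section Semidirect.
Variables (K : fieldType) (A V : superspace K).

Definition semidirect_mul (mu : A -> A -> A) (L : A -> V -> V)
    (p q : ssum A V) : ssum A V :=
  (mu p.1 q.1, L p.1 q.2 + sflip L p.2 q.1).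

Definition semidirect_twist (alpha : 'End(A)) (beta : 'End(V)) :
    'End(ssum A V) :=
  linfun (fun p : A * V => (alpha p.1, beta p.2)).

Lemma semidirect_twistE alpha beta (p : A * V) :
  semidirect_twist alpha beta p = (alpha p.1, beta p.2).
Proof.
have lin : linear (fun p : A * V => (alpha p.1, beta p.2)).
  by move=> a u v; rewrite /= !linearP.
pose g := HB.pack_for {linear (A * V)%type -> (A * V)%type}
  (fun p : A * V => (alpha p.1, beta p.2))
  (GRing.isLinear.Build _ _ _ _ _ lin).
exact: (lfunE g p).
Qed.

End Semidirect.

Definition natural_form (K : fieldType) (A : superspace K)
    (p q : ssum A (sdual A)) : K :=
  sflip (fun (zeta : sdual A) (x : A) => (zeta : 'Hom(A, K^o)) x) p.1 q.2
  + (p.2 : 'Hom(A, K^o)) q.1.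

(* Main.v *)
Require Import Defs.
From HB Require Import structures.
From mathcomp Require Import all_boot all_order all_algebra.
From mathcomp Require Import ring.

Set Implicit Arguments.
Unset Strict Implicit.
Unset Printing Implicit Defensive.

Import GRing.Theory.
Local Open Scope ring_scope.

(* (i) B(x * y, .) is prescribed, so nondegeneracy and bijectivity of alpha give
   the product, and compatibility is the cocycle identity itself.  Paired with
   alpha^2(w), the first anti-Zinbiel identity is Hom-associativity; the second
   says that f_z := B(alpha^2 z, xyw) is, up to Koszul sign, the same for every
   choice of the separated letter among x, y, z, w.  The cocycle identity on the
   triples (xy, z, w) and (zw, x, y) gives f_z + f_w = f_x + f_y, and likewise
   f_x + f_w = f_y + f_z, whence 2 f_z = 2 f_x.
   (ii) The first anti-Zinbiel identity says that Ldual is a representation of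
   the sub-adjacent algebra, which makes the semidirect product Hom-associative.
   In the cocycle sum for the natural form, the terms containing a given
   functional eta pair it with mu(x, y) - (x * y) -+ (y * x) = 0. *)

(** * Koszul signs as conditionals on parities *)

Section Koszul.
Variable R : pzRingType.
Implicit Types i j k : bool.

Lemma koszul1 i j : (-1) ^+ (i * j) = (if i && j then -1 else 1) :> R.
Proof. by case: i j => [] []. Qed.

(** The exponent is a sum in nat and may equal 2; only its residue modulo 2 matters, which is
    governed by the xor. With signs as conditionals, a case split on parities leaves identities for
    [ring]. *)
Lemma koszul2 i j k :
  (-1) ^+ (i * (j + k)) = (if i && (j (+) k) then -1 else 1) :> R.
Proof. by case: i j k => [] [] []; rewrite //= expr2 mulN1r opprK. Qed.

Definition koszulE := (koszul1, koszul2).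
End Koszul.

(** * Bilinear maps on superspaces and representation of functionals *)

Section Bilinear.
Variables (K : fieldType).

Lemma linfunE_linear (U W : vectType K) (f : U -> W) :
  linear f -> linfun f =1 f.
Proof.
move=> lin; pose g := HB.pack_for {linear U -> W} f
  (GRing.isLinear.Build _ _ _ _ _ lin).
exact: (lfunE g).
Qed.

Section Bilinear_for.
Variables (U V : lmodType K) (W : zmodType) (s s' : GRing.Scale.law K W).
Variables (f : U -> V -> W).
Hypothesis fbil : bilinear_for s s' f.

(** Bundled partial maps let the generic facts on linear maps apply to a map known only through
    [bilinear_for]; abstract scale laws cover products and scalar-valued forms alike. *)
Definition bilinear_left v : {linear U -> W | s} :=
  HB.pack_for {linear U -> W | s} (f^~ v)
    (GRing.isLinear.Build _ _ _ _ _ (fbil.1 v)).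
Definition bilinear_right u : {linear V -> W | s'} :=
  HB.pack_for {linear V -> W | s'} (f u)
    (GRing.isLinear.Build _ _ _ _ _ (fbil.2 u)).

Lemma bil0l v : f 0 v = 0. Proof. exact: (linear0 (bilinear_left v)). Qed.
Lemma bil0r u : f u 0 = 0. Proof. exact: (linear0 (bilinear_right u)). Qed.
Lemma bilDl u u' v : f (u + u') v = f u v + f u' v.
Proof. exact: (linearD (bilinear_left v)). Qed.
Lemma bilDr u v v' : f u (v + v') = f u v + f u v'.
Proof. exact: (linearD (bilinear_right u)). Qed.
Lemma bilNl u v : f (- u) v = - f u v.
Proof. exact: (linearN (bilinear_left v)). Qed.
Lemma bilZl a u v : f (a *: u) v = s a (f u v).
Proof. exact: (linearZ_LR (bilinear_left v)). Qed.
Lemma bilZr a u v : f u (a *: v) = s' a (f u v).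
Proof. exact: (linearZ_LR (bilinear_right u)). Qed.

End Bilinear_for.

Lemma sflip_bilinear (A V : superspace K) (W : lmodType K) (f : V -> A -> W) :
  bilinear_for *:%R *:%R f -> bilinear_for *:%R *:%R (sflip f).
Proof.
move=> fb; split=> [y a x x'|x a y y'] /=;
  rewrite /sflip scaler_sumr -big_split;
  apply: eq_bigr => i _; rewrite scaler_sumr -big_split; apply: eq_bigr => j _;
  rewrite !linearP /= ?(bilDl fb, bilDr fb, bilZl fb, bilZr fb) scalerDr;
  by rewrite !scalerA mulrC.
Qed.

Lemma superspace_ind (A : superspace K) (P : A -> Prop) :
    (forall i x, x \in parity A i -> P x) ->
    (forall x y, P x -> P y -> P (x + y)) -> forall x, P x.
Proof.
move=> Ph PD x; rewrite -[x]hproj_sum.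
by apply: PD; apply: Ph (mem_hproj _ _).
Qed.

(** Bridge from the definitions, whose identities concern homogeneous elements only, to statements
    about all vectors: both arguments split into homogeneous components. *)
Lemma bilinear_ext (A V : superspace K) (W : zmodType)
    (s1 s2 s3 s4 : GRing.Scale.law K W) (f g : A -> V -> W) :
    bilinear_for s1 s2 f -> bilinear_for s3 s4 g ->
    (forall i j x y, x \in parity A i -> y \in parity V j -> f x y = g x y) ->
  forall x y, f x y = g x y.
Proof.
move=> fb gb fg; elim/superspace_ind=> [i x xi|x x' IH IH' y]; last first.
  by rewrite (bilDl fb) (bilDl gb) IH IH'.
elim/superspace_ind=> [j y yj|y y' IH IH']; first exact: fg xi yj.
by rewrite (bilDr fb) (bilDr gb) IH IH'.
Qed.

(** The map from x to B(x, .) is injective, hence onto the dual by equality of dimensions. Its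
    inverse [S] is linear, which later makes the product bilinear. *)
Lemma riesz (U : vectType K) (B : U -> U -> K) :
    bilinear_for *%R *%R B -> (forall x, (forall y, B x y = 0) -> x = 0) ->
  exists S : 'Hom('Hom(U, K^o), U), forall phi y, B (S phi) y = phi y.
Proof.
move=> Bb Bnd.
have Br x : linear (B x : U -> K^o) by exact: Bb.2.
pose b x : 'Hom(U, K^o) := linfun (B x : U -> K^o).
have bE x y : b x y = B x y by exact: linfunE_linear.
have bl : linear b.
  move=> a x y; apply/lfunP=> z.
  by rewrite add_lfunE scale_lfunE !bE (bilDl Bb) (bilZl Bb).
pose T : 'Hom(U, 'Hom(U, K^o)) := linfun b.
have TE : T =1 b by exact: linfunE_linear.
have T0 : lker T == 0%VS.
  rewrite -subv0; apply/subvP=> x; rewrite memv_ker memv0 TE => /eqP bx0.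
  by apply/eqP/Bnd=> y; rewrite -bE bx0 lfunE.
have Tf : limg T = fullv.
  apply/eqP; rewrite eqEdim subvf limg_dim_eq ?(eqP T0) ?capv0 //.
  by rewrite !dimvf /dim /= muln1.
exists (T^-1)%VF => phi y.
by rewrite -bE -TE limg_lfunVK // Tf memvf.
Qed.

End Bilinear.

(** * Bilinearity of the sub-adjacent product *)

Section SubadjacentBilinear.
Variables (K : fieldType) (A : superspace K) (star : A -> A -> A).
Hypothesis starb : bilinear_for *:%R *:%R star.

Lemma subadjacentE i j x y : x \in parity A i -> y \in parity A j ->
  subadjacent star x y = star x y + (-1) ^+ (i * j) *: star y x.
Proof.
move=> xi yj.
by rewrite /subadjacent (sflipE (bil0l starb) (bil0r starb) xi yj).
Qed.

Lemma subadjacent_bilinear : bilinear_for *:%R *:%R (subadjacent star).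
Proof.
have fb := sflip_bilinear starb.
split=> [v a u u'|u a v v'] /=; rewrite /subadjacent
  ?(bilDl starb, bilDr starb, bilZl starb, bilZr starb)
  ?(bilDl fb, bilDr fb, bilZl fb, bilZr fb) scalerDr addrACA //.
Qed.

End SubadjacentBilinear.

(** * Even twists, their inverses and multiplicativity *)

Section EvenMaps.
Variables (K : fieldType) (A : superspace K) (alpha : 'End(A)).
Hypothesis alpha_inj : injective alpha.

Let alphaK : cancel alpha (alpha^-1)%VF.
Proof. exact/lker0_lfunK/lker0P. Qed.
Let alphaVK : cancel (alpha^-1)%VF alpha.
Proof. exact/lker0_lfunVK/lker0P. Qed.

Lemma hproj_eq0_mem i (x : A) : hproj A (~~ i) x = 0 -> x \in parity A i.
Proof.
move=> x0; rewrite -[x]hproj_sum.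
by case: i x0 => /= ->; rewrite ?addr0 ?add0r mem_hproj.
Qed.

(** As [alpha] is even, the wrong-parity component of x is the image of that of its preimage; the
    former vanishes, so by injectivity the latter does. *)
Lemma even_linear_inv : even_linear alpha -> even_linear (alpha^-1)%VF.
Proof.
move=> al_even i x xi; apply/hproj_eq0_mem/alpha_inj; rewrite linear0.
have := hproj_eq0 xi; rewrite -{1}[x]alphaVK -{1}[(alpha^-1)%VF x]hproj_sum.
rewrite !linearD.
have ali j y : hproj A j (alpha (hproj A j y)) = alpha (hproj A j y).
  by rewrite hproj_id // al_even // mem_hproj.
have alNi j y : hproj A (~~ j) (alpha (hproj A j y)) = 0.
  by rewrite hproj_eq0 // al_even // mem_hproj.
by case: i {xi} => /=; rewrite ali ?(alNi true) ?(alNi false) ?addr0 ?add0r.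
Qed.

Lemma hom_multiplicativeE (mu : A -> A -> A) :
    bilinear_for *:%R *:%R mu -> hom_multiplicative mu alpha ->
  {morph alpha : x y / mu x y}.
Proof.
move=> mub mum.
apply: (@bilinear_ext _ _ _ _ *:%R *:%R *:%R *:%R _ _ _ _ mum).
  by split=> [y a u v|x a u v] /=;
    rewrite ?(bilDl mub, bilDr mub, bilZl mub, bilZr mub) linearP.
by split=> [y a u v|x a u v] /=;
  rewrite linearP ?(bilDl mub, bilDr mub, bilZl mub, bilZr mub).
Qed.

Lemma morph_inv (mu : A -> A -> A) :
  {morph alpha : x y / mu x y} -> {morph (alpha^-1)%VF : x y / mu x y}.
Proof. by move=> mum x y; apply: alpha_inj; rewrite mum !alphaVK. Qed.

End EvenMaps.

(** * Testing parity and equality against an even nondegenerate form *)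

Section NondegenerateForms.
Variables (K : fieldType) (A : superspace K) (B : A -> A -> K).
Hypothesis Beven : even_bilinear_form B.
Hypothesis Bnd : forall x, (forall y, B x y = 0) -> x = 0.
Let Bb : bilinear_for *%R *%R B := Beven.1.

(** The component of x of parity [~~ i] is orthogonal to everything: to parity i since the form is
    even, to parity [~~ i] since x is and its other component is by evenness. *)
Lemma nondegenerate_parity i x :
  (forall y, y \in parity A (~~ i) -> B x y = 0) -> x \in parity A i.
Proof.
move=> x0; apply: hproj_eq0_mem; apply: Bnd.
elim/superspace_ind=> [j y yj|y y' IH IH'].
  have [jE|/eqP] := eqVneq j (~~ i).
    rewrite jE in yj; have := x0 y yj.
    have := Beven.2 _ _ _ (mem_hproj i x) yj.
    rewrite -{2}[x]hproj_sum (bilDl Bb).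
    by case: (i) => /= ->; rewrite ?addr0 ?add0r.
  move=> jE; apply: (Beven.2 (~~ i)); first exact: mem_hproj.
  by rewrite negbK; case: (i) (j) jE yj => [] [].
by rewrite (bilDr Bb) IH IH' addr0.
Qed.

(** Test vectors may be taken of the form f(y) with y homogeneous; f will be [alpha] or its square,
    since the product is only prescribed against values of [alpha]. *)
Lemma nondegenerate_inj (f : A -> A) x x' :
    (forall y, exists z, y = f z) -> {morph f : y z / y + z} ->
    (forall i y, y \in parity A i -> B x (f y) = B x' (f y)) -> x = x'.
Proof.
move=> fsurj fD xx'; apply/eqP; rewrite -subr_eq0; apply/eqP/Bnd=> y.
have [z ->] := fsurj y; rewrite (bilDl Bb) (bilNl Bb).
elim/superspace_ind: z => [i z /xx'->|z z' IH IH']; first exact: subrr.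
by rewrite fD !(bilDr Bb) opprD addrACA IH IH' addr0.
Qed.

End NondegenerateForms.

(** * From a cocycle to a compatible anti-Zinbiel product *)

Section CocycleToZinbiel.
Variables (K : fieldType) (A : superspace K).
Variables (mu : A -> A -> A) (alpha : 'End(A)) (B : A -> A -> K).
Hypothesis char_neq2 : (2 : K) != 0.
Hypothesis muHA : supercomm_hom_assoc mu alpha.
Hypothesis muM : {morph alpha : x y / mu x y}.
Hypothesis Bcoc : connes_cocycle mu alpha B.
Hypothesis Bnd : nondegenerate_form B.
Hypothesis Binv : forall x y, B (alpha x) (alpha y) = B x y.

Let mub : bilinear_for *:%R *:%R mu. Proof. by case: muHA => - []. Qed.
Let mu_even i j x y : x \in parity A i -> y \in parity A j ->
  mu x y \in parity A (i (+) j).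
Proof. by case: muHA => - [_ muE] _ _ _; apply: muE. Qed.
Let al_even : even_linear alpha. Proof. by case: muHA. Qed.
Let muC : supercommutative mu. Proof. by case: muHA. Qed.
Let muA : hom_associative mu alpha. Proof. by case: muHA. Qed.
Let Beven : even_bilinear_form B. Proof. by case: Bcoc. Qed.
Let Bb : bilinear_for *%R *%R B := Beven.1.
Let Bsym : supersymmetric B. Proof. by case: Bcoc. Qed.

(** An isometry of a nondegenerate form has trivial kernel; in finite dimension [alpha] is then
    bijective. *)
Lemma invariant_form_inj : injective alpha.
Proof.
move=> x y xy; apply/eqP; rewrite -subr_eq0; apply/eqP/Bnd.1=> z.
by rewrite -Binv (linearB alpha) /= xy subrr (bil0l Bb).
Qed.

(** Moving the separated letter from z to x is what the second anti-Zinbiel identity becomes once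
    paired with alpha^2(w). *)
Lemma cocycle_swap i j k l x y z w :
    x \in parity A i -> y \in parity A j ->
    z \in parity A k -> w \in parity A l ->
  B (alpha (alpha z)) (mu (alpha y) (mu x w))
    = (-1) ^+ (i * (j + k)) * B (alpha (alpha x)) (mu (alpha z) (mu y w)).
Proof.
move=> xi yj zk wl.
have axi := al_even xi; have ayj := al_even yj; have azk := al_even zk.
have awl := al_even wl; have aaxi := al_even axi; have aazk := al_even azk.
have xy := mu_even xi yj; have zw := mu_even zk wl.
have yz := mu_even yj zk; have wx := mu_even wl xi.
have [_ _ coc] := Bcoc.
have := coc _ _ _ _ _ _ yz awl axi; have := coc _ _ _ _ _ _ wx ayj azk.
have := coc _ _ _ _ _ _ zw axi ayj; have := coc _ _ _ _ _ _ xy azk awl.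
(* Multiplicativity and invariance strip the twist from the middle term of each identity, leaving
   B(zw, xy) or B(wx, yz), up to order and sign; each occurs in two of the four. *)
rewrite -!muM !Binv.
rewrite (muC awl xy) (muC zw axi) -!(muA xi zk wl, muA yj zk wl, muA xi yj zk).
rewrite (muA wl xi yj) (muC awl xy).
rewrite -(muA zk wl xi) (muC zw axi) -(muA xi zk wl).
rewrite -(muA yj xi wl) (muC yj xi) -(muA zk yj wl) (muC zk yj).
rewrite !(bilZl mub) !(bilZl Bb) !(bilZr Bb).
rewrite (Bsym zw xy) (Bsym wx yz).
rewrite (Bsym aazk (mu_even xy awl)) (Bsym aaxi (mu_even yz awl)) !koszulE.
(* Six values remain: four with one separated letter and the two pairings of products. *)
move: (B _ _) (B _ _) (B _ _) (B _ _) (B _ _) (B _ _) => fx fy fz g fw g'.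
move=> e1 e2 e4 e3; apply: (mulfI char_neq2).
have comb a b c d s : a = 0 -> b = 0 -> c = 0 -> d = 0 ->
  forall L R : K, L - R = s * (a - (-1) ^+ ((i (+) j) * (k (+) l)) * b
    + (-1) ^+ (l * (i (+) j (+) k)) * c
    - (-1) ^+ (i * (j (+) k (+) l)) * d) -> L = R.
  move=> -> -> -> -> L R; rewrite !mulr0 !subr0 addr0 mulr0 => /eqP.
  by rewrite subr_eq0 => /eqP.
(* Up to sign, 2 (f_z - f_x) is the alternating sum of the four cocycle
   identities, each reordered to the word xyzw. *)
apply: (comb _ _ _ _ ((-1) ^+ (i * j) * (-1) ^+ (k * (i (+) j))) e1 e2 e4 e3).
by rewrite !koszulE; case: (i) (j) (k) (l) => [] [] [] [] /=; ring.
Qed.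

(** What B(x * y, .) must be, up to sign, after replacing z by its preimage under [alpha]. With y
    first, [sflip] supplies the Koszul sign. *)
Definition cocycle_functional (y x : A) : 'Hom(A, K^o) :=
  linfun (fun z => B (alpha y) (mu x ((alpha^-1)%VF z)) : K^o).

Lemma cocycle_functionalE y x z :
  cocycle_functional y x z = B (alpha y) (mu x ((alpha^-1)%VF z)).
Proof.
apply: (@linfunE_linear K A K^o) => a u v /=.
by rewrite linearP (bilDr mub) (bilZr mub) (bilDr Bb) (bilZr Bb).
Qed.

Lemma cocycle_functional_bilinear : bilinear_for *:%R *:%R cocycle_functional.
Proof.
split=> [x a y y'|y a x x'] /=; apply/lfunP=> z;
  rewrite add_lfunE scale_lfunE !cocycle_functionalE.
  by rewrite linearP (bilDl Bb) (bilZl Bb).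
by rewrite (bilDl mub) (bilZl mub) (bilDr Bb) (bilZr Bb).
Qed.

Lemma cocycle_star_exists : exists star : A -> A -> A,
  bilinear_for *:%R *:%R star /\
  forall i j x y z, x \in parity A i -> y \in parity A j ->
    B (star x y) (alpha z) = - ((-1) ^+ (i * j) * B (alpha y) (mu x z)).
Proof.
have [S SE] := riesz Bb Bnd.1.
have cfb := cocycle_functional_bilinear.
have sfb := sflip_bilinear cfb.
exists (fun x y => - S (sflip cocycle_functional x y)); split.
  split=> [y a x x'|x a y y'] /=;
    rewrite ?(bilDl sfb, bilDr sfb, bilZl sfb, bilZr sfb) linearP opprD;
    by rewrite scalerN.
move=> i j x y z xi yj; rewrite (bilNl Bb) SE.
rewrite (sflipE (bil0l cfb) (bil0r cfb) xi yj).
rewrite scale_lfunE cocycle_functionalE lker0_lfunK //.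
exact/lker0P/invariant_form_inj.
Qed.

Section Star.
Variable star : A -> A -> A.
Hypothesis starb : bilinear_for *:%R *:%R star.
Hypothesis starE : forall i j x y z, x \in parity A i -> y \in parity A j ->
  B (star x y) (alpha z) = - ((-1) ^+ (i * j) * B (alpha y) (mu x z)).

Let alphaVK : cancel (alpha^-1)%VF alpha.
Proof. exact/lker0_lfunVK/lker0P/invariant_form_inj. Qed.

Let alV_even : even_linear (alpha^-1)%VF.
Proof. exact/even_linear_inv/al_even/invariant_form_inj. Qed.

(** Against z of parity opposite to that of xy, the defining formula pairs alpha(y) with a vector of
    parity opposite to j, giving 0. *)
Lemma cocycle_star_parity i j x y : x \in parity A i -> y \in parity A j ->
  star x y \in parity A (i (+) j).
Proof.
move=> xi yj; apply: (nondegenerate_parity Beven Bnd.1) => z zk.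
rewrite -[z]alphaVK (starE _ xi yj) (Beven.2 j) ?mulr0 ?oppr0 //.
  exact: al_even.
by move: (mu_even xi (alV_even zk)); rewrite addbN addKb.
Qed.

Lemma cocycle_star_compatible : compatible star mu.
Proof.
move=> x y.
apply: (bilinear_ext (subadjacent_bilinear starb) mub) => i j {}x {}y xi yj.
apply: (nondegenerate_inj Beven Bnd.1 (f := alpha)) => [z|u v|k z zk].
- by exists ((alpha^-1)%VF z).
- exact: linearD.
have [_ _ coc] := Bcoc.
rewrite (subadjacentE starb xi yj) (bilDl Bb) (bilZl Bb).
rewrite (starE _ xi yj) (starE _ yj xi).
have := coc _ _ _ _ _ _ xi yj zk; rewrite (muC zk xi) (bilZl Bb).
rewrite (Bsym (mu_even yj zk) (al_even xi)) (Bsym (mu_even xi zk) (al_even yj)).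
rewrite !koszulE; move: (B _ _) (B _ _) (B _ _) => a b c /eqP.
rewrite -addrA addr_eq0 => /eqP ->.
by case: (i) (j) (k) => [] [] [] /=; ring.
Qed.

Let star_pair i j k x y z w :
  x \in parity A i -> y \in parity A j -> z \in parity A k ->
  B (star (alpha x) (star y z)) (alpha (alpha w))
   = (-1) ^+ (i * (j + k)) * (-1) ^+ (j * k)
     * B (alpha (alpha z)) (mu (alpha y) (mu x w)).
Proof.
move=> xi yj zk; rewrite (starE _ (al_even xi) (cocycle_star_parity yj zk)).
(* Writing xw as a value of [alpha] makes the defining formula applicable a second time, to y *
   z. *)
rewrite -muM Binv -[mu x w]alphaVK (starE _ yj zk) -[in RHS]muM Binv.
by rewrite !koszulE; case: (i) (j) (k) => [] [] [] /=; ring.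
Qed.

Lemma cocycle_star_zinbiel : hom_anti_zinbiel star alpha.
Proof.
split=> //; first by split=> //; apply: cocycle_star_parity.
  move=> i j k x y z xi yj zk.
  apply: (nondegenerate_inj Beven Bnd.1 (f := alpha \o alpha))
    => [w|u v|l w wl].
  - by exists ((alpha^-1)%VF ((alpha^-1)%VF w)); rewrite /= !alphaVK.
  - by rewrite /= !linearD.
  rewrite /= (star_pair _ xi yj zk) (bilNl Bb).
  have := cocycle_star_compatible x y.
  rewrite (subadjacentE starb xi yj) => ->.
  rewrite (starE _ (mu_even xi yj) (al_even zk)) (muC xi yj).
  rewrite (bilZl mub) (bilZr Bb) (muA yj xi wl) !koszulE.
  by case: (i) (j) (k) => [] [] [] /=; ring.
move=> i j k x y z xi yj zk.
apply: (nondegenerate_inj Beven Bnd.1 (f := alpha \o alpha)) => [w|u v|l w wl].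
- by exists ((alpha^-1)%VF ((alpha^-1)%VF w)); rewrite /= !alphaVK.
- by rewrite /= !linearD.
rewrite /= (bilZl Bb) (star_pair _ xi yj zk) (star_pair _ yj zk xi).
rewrite (cocycle_swap xi yj zk wl) !koszulE.
by case: (i) (j) (k) => [] [] [] /=; ring.
Qed.

End Star.

(** Since [alpha] is onto, the prescribed pairings exhaust all test vectors, so the formula truly
    defines the product. *)
Lemma cocycle_star_unique (star star' : A -> A -> A) :
    bilinear_for *:%R *:%R star -> bilinear_for *:%R *:%R star' ->
    (forall i j k x y z,
      x \in parity A i -> y \in parity A j -> z \in parity A k ->
      B (star x y) (alpha z) = B (star' x y) (alpha z)) ->
  forall x y, star x y = star' x y.
Proof.
move=> sb sb' ss'; apply: (bilinear_ext sb sb') => i j x y xi yj.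
apply: (nondegenerate_inj Beven Bnd.1 (f := alpha)) => [z|u v|k z zk].
- exists ((alpha^-1)%VF z).
  by rewrite (lker0_lfunVK (introT lker0P invariant_form_inj)).
- exact: linearD.
exact: ss' xi yj zk.
Qed.

End CocycleToZinbiel.

(** * The sub-adjacent Hom-associative superalgebra *)

Section Subadjacent.
Variables (K : fieldType) (A : superspace K).
Variables (star : A -> A -> A) (alpha : 'End(A)).
Hypothesis starZ : hom_anti_zinbiel star alpha.

Let starb : bilinear_for *:%R *:%R star. Proof. by case: starZ => - []. Qed.
Let star_even i j x y : x \in parity A i -> y \in parity A j ->
  star x y \in parity A (i (+) j).
Proof. by case: starZ => - [_ sE] _ _ _; apply: sE. Qed.
Let al_even : even_linear alpha. Proof. by case: starZ. Qed.

Lemma subadjacent_supercommutative : supercommutative (subadjacent star).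
Proof.
move=> i j x y xi yj.
rewrite (subadjacentE starb xi yj) (subadjacentE starb yj xi).
rewrite scalerDr scalerA mulnC addrC; congr (_ + _).
by rewrite -expr2 sqrr_sign scale1r.
Qed.

(** The first anti-Zinbiel identity rewrites each product with a composite left factor, and the
    second, a cyclic symmetry, brings every term to alpha(x) * (y * z) or alpha(x) * (z * y). On
    both sides only the latter survives, with equal signs. *)
Lemma subadjacent_supercomm_hom_assoc :
  supercomm_hom_assoc (subadjacent star) alpha.
Proof.
have muE i j x y : x \in parity A i -> y \in parity A j ->
    subadjacent star x y \in parity A (i (+) j).
  move=> xi yj; rewrite (subadjacentE starb xi yj) memvD ?star_even //.
  by rewrite memvZ // addbC star_even.
split=> //; first by split=> //; exact: (subadjacent_bilinear starb).
  exact: subadjacent_supercommutative.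
have [_ _ Z1 Z2] := starZ.
move=> i j k x y z xi yj zk.
rewrite (subadjacentE starb (muE _ _ _ _ xi yj) (al_even zk)).
rewrite (subadjacentE starb (al_even xi) (muE _ _ _ _ yj zk)).
rewrite (subadjacentE starb xi yj) (subadjacentE starb yj zk).
have := congr1 -%R (Z1 _ _ _ _ _ _ xi yj zk); rewrite opprK => <-.
have := congr1 -%R (Z1 _ _ _ _ _ _ yj zk xi); rewrite opprK => <-.
rewrite !(bilDr starb) !(bilZr starb).
rewrite (Z2 _ _ _ _ _ _ yj zk xi) (Z2 _ _ _ _ _ _ zk xi yj).
rewrite (Z2 _ _ _ _ _ _ zk yj xi) (Z2 _ _ _ _ _ _ yj xi zk) !koszulE.
by case: (i) (j) (k) => [] [] [] /=;
  rewrite ?(scale1r, scaleN1r, opprK, opprD) addKr addrC ?addKr ?addNKr.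
Qed.

Lemma subadjacent_morph :
  {morph alpha : x y / star x y} -> {morph alpha : x y / subadjacent star x y}.
Proof.
move=> starM; apply: hom_multiplicativeE (subadjacent_bilinear starb) _.
move=> i j x y xi yj; rewrite (subadjacentE starb xi yj).
rewrite (subadjacentE starb (al_even xi) (al_even yj)).
by rewrite linearD linearZ /= !starM.
Qed.

End Subadjacent.

(** * Semidirect products with a representation *)

Section Semidirect.
Variables (K : fieldType) (A V : superspace K).
Variables (mu : A -> A -> A) (alpha : 'End(A)).
Variables (L : A -> V -> V) (beta : 'End(V)).
Hypothesis muHA : supercomm_hom_assoc mu alpha.
Hypothesis Lb : bilinear_for *:%R *:%R L.
Hypothesis L_even : forall i j x v, x \in parity A i -> v \in parity V j ->
  L x v \in parity V (i (+) j).
Hypothesis beta_even : even_linear beta.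
Hypothesis L_rep : forall i j k x y v,
  x \in parity A i -> y \in parity A j -> v \in parity V k ->
  L (mu x y) (beta v) = L (alpha x) (L y v).

Let mub : bilinear_for *:%R *:%R mu. Proof. by case: muHA => - []. Qed.
Let mu_even i j x y : x \in parity A i -> y \in parity A j ->
  mu x y \in parity A (i (+) j).
Proof. by case: muHA => - [_ muE] _ _ _; apply: muE. Qed.
Let al_even : even_linear alpha. Proof. by case: muHA. Qed.
Let muC : supercommutative mu. Proof. by case: muHA. Qed.
Let muA : hom_associative mu alpha. Proof. by case: muHA. Qed.

Lemma semidirect_mulE i j (p q : ssum A V) :
    p \in parity (ssum A V) i -> q \in parity (ssum A V) j ->
  semidirect_mul mu L p q =
    (mu p.1 q.1, L p.1 q.2 + (-1) ^+ (i * j) *: L q.1 p.2).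
Proof.
rewrite !mem_ssum_parity => /andP[_ p2] /andP[q1 _].
by rewrite /semidirect_mul (sflipE (bil0l Lb) (bil0r Lb) p2 q1).
Qed.

Lemma semidirect_supercomm_hom_assoc :
  supercomm_hom_assoc (semidirect_mul mu L) (semidirect_twist alpha beta).
Proof.
have mul_even i j (p q : ssum A V) :
    p \in parity (ssum A V) i -> q \in parity (ssum A V) j ->
    semidirect_mul mu L p q \in parity (ssum A V) (i (+) j).
  move=> pi qj; rewrite (semidirect_mulE pi qj).
  move: pi qj; rewrite !mem_ssum_parity /= => /andP[p1 p2] /andP[q1 q2].
  rewrite mu_even // memvD ?L_even // memvZ //.
  by rewrite addbC L_even.
have tw_even : even_linear (semidirect_twist alpha beta).
  move=> i p; rewrite semidirect_twistE !mem_ssum_parity /=.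
  by case/andP=> /al_even -> /beta_even ->.
split=> //.
- split=> //; have fb := sflip_bilinear Lb.
  split=> [q a p p'|p a q q'] /=; rewrite /semidirect_mul /=;
    rewrite ?(bilDl mub, bilDr mub, bilZl mub, bilZr mub)
      ?(bilDl fb, bilDr fb, bilZl fb, bilZr fb)
      ?(bilDl Lb, bilDr Lb, bilZl Lb, bilZr Lb);
  by congr pair; rewrite /= scalerDr addrACA.
- move=> i j p q pi qj; rewrite (semidirect_mulE pi qj) (semidirect_mulE qj pi).
  move: pi qj; rewrite !mem_ssum_parity /= => /andP[p1 _] /andP[q1 _].
  rewrite (muC p1 q1); congr pair; rewrite /= scalerDr scalerA mulnC addrC.
  by rewrite -expr2 sqrr_sign scale1r.
move=> i j k p q r pi qj rk.
rewrite (semidirect_mulE (mul_even _ _ _ _ pi qj) (tw_even _ _ rk)).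
rewrite (semidirect_mulE (tw_even _ _ pi) (mul_even _ _ _ _ qj rk)).
rewrite (semidirect_mulE pi qj) (semidirect_mulE qj rk) !semidirect_twistE.
move: pi qj rk; rewrite !mem_ssum_parity /=.
move=> /andP[p1 p2] /andP[q1 q2] /andP[r1 r2].
rewrite (muA p1 q1 r1); congr pair.
(* Each nested action becomes the action of a product on a twisted vector. One term per module
   component is left on each side, and these match by supercommutativity. *)
rewrite !(bilDr Lb) !(bilZr Lb) -(L_rep p1 q1 r2) -(L_rep r1 p1 q2).
rewrite -(L_rep r1 q1 p2) -(L_rep p1 r1 q2) (muC r1 p1) (muC r1 q1).
rewrite !(bilZl Lb) -addrA; congr (_ + _); rewrite scalerDr !scalerA !koszulE.
by congr (_ *: _ + _ *: _); case: (i) (j) (k) => [] [] [] /=; ring.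
Qed.

End Semidirect.

(** * The dual representation *)

Section Ldual.
Variables (K : fieldType) (A : superspace K).
Variables (star : A -> A -> A) (alpha : 'End(A)).
Hypothesis starZ : hom_anti_zinbiel star alpha.
Hypothesis starM : {morph alpha : x y / star x y}.
Hypothesis alpha_inj : injective alpha.

Let star_ebil : even_bilinear star. Proof. by case: starZ. Qed.
Let starb : bilinear_for *:%R *:%R star := star_ebil.1.
Let star_even := star_ebil.2.
Let al_even : even_linear alpha. Proof. by case: starZ. Qed.
Let alphaK : cancel alpha (alpha^-1)%VF.
Proof. exact/lker0_lfunK/lker0P. Qed.
Let alphaVK : cancel (alpha^-1)%VF alpha.
Proof. exact/lker0_lfunVK/lker0P. Qed.
Let alV_even := even_linear_inv alpha_inj al_even.
Let starVM := morph_inv alpha_inj starM.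

Lemma Ldual_bilinear : bilinear_for *:%R *:%R (Ldual star alpha).
Proof.
pose g y : 'End(A) := linfun (fun v =>
  star ((alpha^-1)%VF y) ((alpha^-1)%VF ((alpha^-1)%VF v))).
have gE y v :
    g y v = star ((alpha^-1)%VF y) ((alpha^-1)%VF ((alpha^-1)%VF v)).
  apply: linfunE_linear => a u w.
  by rewrite !linearP (bilDr starb) (bilZr starb).
have fb : bilinear_for *:%R *:%R
    (fun (zeta : sdual A) y => ((zeta : 'Hom(A, K^o)) \o g y)%VF : sdual A).
  split=> [y a u w|u a y w] /=; first by rewrite comp_lfunDl comp_lfunZl.
  apply/lfunP=> v; rewrite add_lfunE scale_lfunE !comp_lfunE !gE.
  by rewrite linearP (bilDl starb) (bilZl starb) linearP.
have sb := sflip_bilinear fb.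
split=> [y a u w|u a y w] /=; rewrite /Ldual;
  rewrite ?(bilDl sb, bilDr sb, bilZl sb, bilZr sb) opprD;
  by rewrite scalerN.
Qed.

Lemma Ldual_parity i j x (xi : sdual A) :
    x \in parity A i -> xi \in parity (sdual A) j ->
  Ldual star alpha x xi \in parity (sdual A) (i (+) j).
Proof.
move=> xp zj; apply/mem_sdual_parity => v vk.
rewrite (Ldual_homogE _ _ star_ebil xp zj).
have /mem_sdual_parity -> := zj; first by rewrite mulr0 oppr0.
have := star_even (alV_even xp) (alV_even (alV_even vk)).
by rewrite addbN addKb.
Qed.

Let beta : 'End(sdual A) := transpose_lfun (alpha^-1)%VF.

Lemma transpose_inv_even : even_linear beta.
Proof.
move=> i xi /mem_sdual_parity xi0; apply/mem_sdual_parity => v vi.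
by rewrite /beta transpose_lfunE comp_lfunE; apply/xi0/alV_even.
Qed.

Lemma Ldual_representation i j k x y (xi : sdual A) :
    x \in parity A i -> y \in parity A j -> xi \in parity (sdual A) k ->
  Ldual star alpha (subadjacent star x y) (beta xi)
    = Ldual star alpha (alpha x) (Ldual star alpha y xi).
Proof.
move=> xp yj zk; apply/lfunP => v.
have muHA := subadjacent_supercomm_hom_assoc starZ.
have [[_ mu_even] _ muC _] := muHA.
rewrite (Ldual_homogE _ _ star_ebil (mu_even _ _ _ _ xp yj)
  (transpose_inv_even zk)).
rewrite (Ldual_homogE _ _ star_ebil (al_even xp) (Ldual_parity yj zk)).
rewrite (Ldual_homogE _ _ star_ebil yj zk) alphaK.
rewrite /beta transpose_lfunE comp_lfunE.
have [_ _ Z1 _] := starZ.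
have muVM := morph_inv alpha_inj (subadjacent_morph starZ starM).
have x2 := alV_even (alV_even xp); have y2 := alV_even (alV_even yj).
(* The four inverses accumulate from two nested uses of [Ldual]. The first anti-Zinbiel identity is
   then applied to alpha^-2(y), alpha^-2(x) and w, the last split into homogeneous parts. *)
set w := (alpha^-1)%VF ((alpha^-1)%VF ((alpha^-1)%VF ((alpha^-1)%VF v))).
have Z : star ((alpha^-1)%VF y) (star ((alpha^-1)%VF ((alpha^-1)%VF x)) w)
    = - star (subadjacent star ((alpha^-1)%VF ((alpha^-1)%VF y))
                ((alpha^-1)%VF ((alpha^-1)%VF x))) (alpha w).
  elim/superspace_ind: w => [l w wl|w w' IH IH'].
    rewrite -{1}[(alpha^-1)%VF y]alphaVK (Z1 _ _ _ _ _ _ y2 x2 wl).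
    by rewrite (subadjacentE starb y2 x2).
  by rewrite linearD !(bilDr starb) IH IH' opprD.
rewrite !starVM Z alphaVK !muVM (muC _ _ _ _ y2 x2) (bilZl starb).
have xiNZ c u : (xi : 'Hom(A, K^o)) (- (c *: u))
    = - (c * (xi : 'Hom(A, K^o)) u).
  by rewrite linearN linearZ.
rewrite xiNZ !koszulE; move: (_ (star _ _)) => a.
by case: (i) (j) (k) => [] [] [] /=; ring.
Qed.

Lemma semidirect_dual_supercomm_hom_assoc :
  supercomm_hom_assoc (semidirect_mul (subadjacent star) (Ldual star alpha))
    (semidirect_twist alpha beta).
Proof.
exact: (semidirect_supercomm_hom_assoc (subadjacent_supercomm_hom_assoc starZ)
  Ldual_bilinear Ldual_parity transpose_inv_even Ldual_representation).
Qed.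

End Ldual.

(** * The natural form: symmetry, nondegeneracy, cocycle identity *)

Section NaturalForm.
Variables (K : fieldType) (A : superspace K).
Implicit Types p q : ssum A (sdual A).

(** A functional of one parity kills vectors of the other, so only the diagonal terms of [sflip]
    survive, the odd one with sign -1. This formula needs no homogeneity. *)
Lemma natural_formE p q :
  natural_form p q =
    (q.2 : 'Hom(A, K^o)) (hproj A false p.1 - hproj A true p.1)
    + (p.2 : 'Hom(A, K^o)) q.1.
Proof.
congr (_ + _); rewrite /sflip !big_bool /=; move: p.1 q.2 => x xi {p q}.
have off i : (hproj (sdual A) (~~ i) xi : 'Hom(A, K^o)) (hproj A i x) = 0.
  have /mem_sdual_parity -> // := mem_hproj (~~ i) xi.
  by rewrite negbK mem_hproj.
rewrite (off true) (off false) !scaler0 add0r addr0.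
rewrite linearB /= -[in RHS](hproj_sum xi) !add_lfunE.
by rewrite (off true) (off false) addr0 add0r scaleN1r scale1r addrC.
Qed.

Lemma natural_form_homogE i j p q :
    p \in parity (ssum A (sdual A)) i -> q \in parity (ssum A (sdual A)) j ->
  natural_form p q = (-1) ^+ (i * j) * (q.2 : 'Hom(A, K^o)) p.1
                     + (p.2 : 'Hom(A, K^o)) q.1.
Proof.
rewrite !mem_ssum_parity => /andP[p1 _] /andP[_ q2].
by rewrite /natural_form (sflipE _ _ p1 q2) // => xi; rewrite ?lfunE ?linear0.
Qed.

Lemma natural_form_even : even_bilinear_form (@natural_form K A).
Proof.
split=> [|i p q pi qi].
  pose d : 'End(A) := (hproj A false - hproj A true)%VF.
  have dE p q : natural_form p q =
      (q.2 : 'Hom(A, K^o)) (d p.1) + (p.2 : 'Hom(A, K^o)) q.1.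
    by rewrite natural_formE /d add_lfunE opp_lfunE.
  have hom_lin (xi : 'Hom(A, K^o)) a u v : xi (a *: u + v) = a * xi u + xi v.
    by rewrite linearP.
  split=> [q a p p'|p a q q'] /=; rewrite !dE /= ?(linearP d) !hom_lin
    add_lfunE scale_lfunE mulrDr; exact: addrACA.
rewrite (natural_form_homogE pi qi); move: pi qi; rewrite !mem_ssum_parity.
move=> /andP[p1 /mem_sdual_parity p2] /andP[q1 /mem_sdual_parity q2].
by rewrite p2 // q2 ?negbK // mulr0 addr0.
Qed.

Lemma natural_form_supersymmetric : supersymmetric (@natural_form K A).
Proof.
move=> i j p q pi qj.
rewrite (natural_form_homogE pi qj) (natural_form_homogE qj pi).
by rewrite !koszulE; case: (i) (j) => [] [] /=; ring.
Qed.

Lemma functionals_separate (U : vectType K) (x : U) :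
  (forall phi : 'Hom(U, K^o), phi x = 0) -> x = 0.
Proof.
move=> phi0; rewrite (coord_vbasis (memvf x)) big1 // => i _.
have lin : linear (coord (vbasis fullv) i : U -> K^o).
  by move=> a u v; rewrite linearP.
have := phi0 (linfun (coord (vbasis fullv) i : U -> K^o)).
by rewrite linfunE_linear // => ->; rewrite scale0r.
Qed.

Lemma natural_form_nondegenerate : nondegenerate_form (@natural_form K A).
Proof.
split=> [[x xi] p0|[x xi] p0].
  have xi0 : xi = 0.
    apply/lfunP=> y; have := p0 (y, 0).
    by rewrite natural_formE /= !lfunE add0r.
  rewrite xi0; congr pair; rewrite -[x]hproj_sum.
  (* Equal even and odd components lie in both parities, hence vanish. *)
  have /eqP : hproj A false x - hproj A true x = 0.
    apply: functionals_separate => phi; have := p0 (0, phi).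
    by rewrite natural_formE /= linear0 addr0.
  rewrite subr_eq0 => /eqP x01.
  have /eqP : hproj A true x \in (0 : {vspace A})%VS.
    by rewrite -(parity_cap A) memv_cap -{1}x01 !mem_hproj.
  by rewrite x01 memv0 => /eqP/eqP ->; rewrite addr0.
have x0 : x = 0.
  apply: functionals_separate => phi; have := p0 (0, phi).
  by rewrite natural_formE /= !(linear0 (hproj A _)) subr0 linear0 add0r.
rewrite x0; congr pair; apply/lfunP=> y; rewrite lfunE /=.
elim/superspace_ind: y => [i y yi|y y' IH IH']; last first.
  by rewrite linearD /= IH IH' addr0.
have := p0 (y, 0); rewrite natural_formE /= lfunE addr0.
have := hproj_eq0 yi; have := hproj_id yi.
case: i {yi} => /= -> ->; last by rewrite subr0.
by rewrite sub0r linearN => /eqP; rewrite oppr_eq0 => /eqP.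
Qed.

Lemma natural_form_cocycle (star : A -> A -> A) (alpha : 'End(A)) :
    hom_anti_zinbiel star alpha -> {morph alpha : x y / star x y} ->
    injective alpha ->
  connes_cocycle
    (semidirect_mul (subadjacent star) (Ldual star alpha)
      : ssum A (sdual A) -> _)
    (semidirect_twist alpha (transpose_lfun (alpha^-1)%VF : 'End(sdual A)))
    (@natural_form K A).
Proof.
move=> starZ starM alpha_inj.
have Lb := Ldual_bilinear starZ.
have star_ebil : even_bilinear star by case: starZ.
have al_even : even_linear alpha by case: starZ.
have [[_ sE] tE _ _] :=
  semidirect_dual_supercomm_hom_assoc starZ starM alpha_inj.
split; [exact: natural_form_even|exact: natural_form_supersymmetric|].
have alphaK : cancel alpha (alpha^-1)%VF by apply/lker0_lfunK/lker0P.
have muVM := morph_inv alpha_inj (subadjacent_morph starZ starM).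
(* The twist on r cancels one inverse in [Ldual], and the transpose puts one on the product, so
   every letter occurs under exactly one [alpha^-1]. *)
have pair_mul i j k p q r : p \in parity (ssum A (sdual A)) i ->
    q \in parity (ssum A (sdual A)) j -> r \in parity (ssum A (sdual A)) k ->
  natural_form
    (semidirect_mul (subadjacent star) (Ldual star alpha) p q)
    (semidirect_twist alpha (transpose_lfun (alpha^-1)%VF : 'End(sdual A)) r)
  = (-1) ^+ ((i (+) j) * k)
      * ((r.2 : 'Hom(A, K^o)) (star ((alpha^-1)%VF p.1) ((alpha^-1)%VF q.1))
         + (-1) ^+ (i * j)
           * (r.2 : 'Hom(A, K^o))
               (star ((alpha^-1)%VF q.1) ((alpha^-1)%VF p.1)))
    - (-1) ^+ (i * j)
        * (q.2 : 'Hom(A, K^o)) (star ((alpha^-1)%VF p.1) ((alpha^-1)%VF r.1))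
    - (p.2 : 'Hom(A, K^o)) (star ((alpha^-1)%VF q.1) ((alpha^-1)%VF r.1)).
  move=> pi qj rk; rewrite (natural_form_homogE (sE _ _ _ _ pi qj) (tE _ _ rk)).
  rewrite (semidirect_mulE _ Lb pi qj) semidirect_twistE /=.
  rewrite transpose_lfunE comp_lfunE muVM add_lfunE scale_lfunE.
  move: pi qj; rewrite !mem_ssum_parity => /andP[p1 p2] /andP[q1 q2].
  have alV_even := even_linear_inv alpha_inj al_even.
  rewrite (subadjacentE star_ebil.1 (alV_even _ _ p1) (alV_even _ _ q1)).
  rewrite (Ldual_homogE _ _ star_ebil p1 q2) (Ldual_homogE _ _ star_ebil q1 p2).
  rewrite alphaK linearD linearZ /= /GRing.scale /= !koszulE.
  by case: (i) (j) (k) => [] [] [] /=; ring.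
move=> i j k p q r pi qj rk.
(* Each functional contributes two terms from its sub-adjacent pairing and one opposite term from
   each of the other two pairings; they cancel. *)
rewrite (pair_mul _ _ _ _ _ _ pi qj rk) (pair_mul _ _ _ _ _ _ qj rk pi).
rewrite (pair_mul _ _ _ _ _ _ rk pi qj) !koszulE.
by case: (i) (j) (k) => [] [] [] /=; ring.
Qed.

End NaturalForm.

(** * Both directions, with uniqueness of the product in the first *)

Theorem corollary3p2 (K : fieldType) (charK0 : [pchar K] =i pred0) :
  (forall (A : superspace K) (mu : A -> A -> A) (alpha : 'End(A))
      (B : A -> A -> K),
    supercomm_hom_assoc mu alpha ->
    hom_multiplicative mu alpha ->
    connes_cocycle mu alpha B ->
    nondegenerate_form B ->
    (forall i j x y, x \in parity A i -> y \in parity A j ->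
      B (alpha x) (alpha y) = B x y) ->
    let defined_by_B (star : A -> A -> A) :=
      forall i j k x y z,
        x \in parity A i -> y \in parity A j -> z \in parity A k ->
        B (star x y) (alpha z)
          = - ((-1) ^+ (i * j) * B (alpha y) (mu x z)) in
    exists star : A -> A -> A,
      [/\ hom_anti_zinbiel star alpha, compatible star mu, defined_by_B star
        & forall star' : A -> A -> A,
            bilinear_for *:%R *:%R star' -> defined_by_B star' ->
            forall x y, star' x y = star x y])
  /\
  (forall (A : superspace K) (star : A -> A -> A) (alpha : 'End(A)),
    hom_anti_zinbiel star alpha ->
    hom_multiplicative star alpha ->
    bijective alpha ->
    let mu := subadjacent star in
    let smul := semidirect_mul mu (Ldual star alpha) in
    let stwist : 'End(ssum A (sdual A)) :=
      semidirect_twist alpha (transpose_lfun (alpha^-1)%VF : 'End(sdual A)) in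
    [/\ supercomm_hom_assoc smul stwist,
        nondegenerate_form (@natural_form K A)
      & connes_cocycle smul stwist (@natural_form K A)]).
Proof.
(* Characteristic 0 enters through the division by 2 in [cocycle_swap]. *)
have char_neq2 : (2 : K) != 0 by rewrite ((pcharf0P K).1 charK0 2).
split=> [A mu alpha B muHA muM Bcoc Bnd Binv|A star alpha starZ starM al_bij].
  move=> defined_by_B.
  have [[mub _] _ _ _] := muHA.
  have Bb : bilinear_for *%R *%R B by case: Bcoc => - [].
  have {}muM := hom_multiplicativeE mub muM.
  have {}Binv x y : B (alpha x) (alpha y) = B x y.
    apply: (bilinear_ext _ Bb Binv).
    split=> [v a u u'|u a v v'] /=;
      by rewrite linearP ?(bilDl Bb, bilDr Bb, bilZl Bb, bilZr Bb).
  have [star [starb starE]] := cocycle_star_exists muHA Bcoc Bnd Binv.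
  exists star; split.
  - exact: cocycle_star_zinbiel starE.
  - exact: cocycle_star_compatible starE.
  - by move=> i j k x y z xi yj _; apply: starE.
  move=> star' starb' starE'; apply: (cocycle_star_unique Bcoc Bnd Binv) => //.
  move=> i j k x y z xi yj zk.
  by rewrite (starE' _ _ _ _ _ _ xi yj zk) (starE _ _ _ _ _ xi yj).
have al_inj := bij_inj al_bij.
have [[starb _] _ _ _] := starZ.
have {}starM := hom_multiplicativeE starb starM.
split; first exact: semidirect_dual_supercomm_hom_assoc.
  exact: natural_form_nondegenerate.
exact: natural_form_cocycle.
Qed.
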